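(* Let $\mathcal{X}\subseteq\mathbb{R}^n$ be nonempty, closed and convex, let $a_0\in\mathbb{R}^n$, let $\mathcal{V}\subset\mathbb{R}^n$ be compact, smooth and strictly convex with $0\in\mathrm{int}(\mathcal{V})$, and let $\varphi(\cdot)=g(\|\cdot\|_{\mathcal{V}^{\circ}})$, where $g:\mathbb{R}\to[0,\infty)$ is Legendre with $g(0)=0$ and $g'(0)=0$. Let $x_{\mathrm{R}}'(\omega)$ be the robust path and let $x_{\mathrm{CP}}(\omega)$ be the central path induced by $\varphi$ and initialized at $x_{\mathrm{R}}=\arg\min_{x\in\mathcal{X}}\varphi(x)$. If $\Pi^{\varphi}_{\mathcal{X}}(0)=\Pi^{\varphi}_{\mathrm{Aff}(\mathcal{X})}(0)$, then $x_{\mathrm{R}}'(\omega)=x_{\mathrm{CP}}(\omega)$ for all $\omega\in(0,\infty)$.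
   Context: For a closed convex set $\mathcal{C}\subseteq\mathbb{R}^n$ containing $0$: the gauge is $\|v\|_{\mathcal{C}}=\inf\{t\ge0: v\in t\mathcal{C}\}$ and the polar is $\mathcal{C}^{\circ}=\{y:\langle x,y\rangle\le1\ \forall x\in\mathcal{C}\}$. $\mathrm{Aff}(\mathcal{X})$ is the affine hull. A convex set with nonempty interior is strictly convex if for distinct boundary points the open segment between them lies in the interior; it is smooth if the supporting hyperplane at each boundary point is unique. A proper closed convex function $\psi:\mathbb{R}^n\to\mathbb{R}\cup\{+\infty\}$ is Legendre if $\mathrm{int}(\mathrm{dom}\,\psi)\ne\varnothing$, $\psi$ is differentiable and strictly convex on $\mathrm{int}(\mathrm{dom}\,\psi)$, and $\|\nabla\psi(x_n)\|_2\to\infty$ whenever $x_n\in\mathrm{int}(\mathrm{dom}\,\psi)$ converges to a boundary point of $\mathrm{dom}\,\psi$. Bregman divergence: $D_\varphi(x,y)=\varphi(x)-\varphi(y)-\langle\nabla\varphi(y),x-y\rangle$. Bregman projection onto a closed convex set $\mathcal{S}$: $\Pi^{\varphi}_{\mathcal{S}}(y)=\arg\min_{x\in\mathcal{S}}D_\varphi(x,y)$. Robust path points: $x_{\mathrm{R}}'(\omega)=\arg\min_{x\in\mathcal{X}}\langle a_0,x\rangle+\omega\varphi(x)$. Central path initialized at $x_{\mathrm{R}}$: $x_{\mathrm{CP}}(\omega)=\arg\min_{x\in\mathcal{X}}\langle a_0,x\rangle+\omega D_\varphi(x,x_{\mathrm{R}})$. These minimizers are taken to exist (they are then unique by strict convexity).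 *)

(* Defs.v *)
(* Vectors of R^n are row vectors 'rV[R]_n. Their library
   norm is the sup norm, used only for the (equivalent) topology and
   differential structure; the Euclidean structure is [dot]/[enorm]. *)
From mathcomp Require Import all_boot all_order all_algebra.
From mathcomp Require Import all_classical all_reals all_analysis.

Set Implicit Arguments.
Unset Strict Implicit.
Unset Printing Implicit Defensive.

Import Order.TTheory GRing.Theory Num.Theory.
Import numFieldNormedType.Exports.

Local Open Scope classical_set_scope.
Local Open Scope ring_scope.

Section Euclidean.
Context {R : realType} {n : nat}.
Implicit Types (x y v p : 'rV[R]_n) (A C H S : set 'rV[R]_n).

Definition dot x y : R := \sum_(i < n) x 0 i * y 0 i.

Definition enorm x : R := Num.sqrt (dot x x).

Definition grad (f : 'rV[R]_n -> R^o) x : 'rV[R]_n :=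
  \row_(i < n) 'D_(delta_mx 0 i) f x.

Definition boundary A : set 'rV[R]_n := closure A `\` A°.

Definition strictly_convex_set C :=
  [/\ convex_set C, C° !=set0 &
    forall x y (t : R), boundary C x -> boundary C y -> x <> y ->
      0 < t < 1 -> C° ((1 - t) *: x + t *: y)].

(* A hyperplane is compared as a set of points, since its normal vector is only
   determined up to a scalar. *)
Definition supporting_hyperplane C p H :=
  exists v, [/\ v <> 0, (forall x, C x -> dot v x <= dot v p) &
    H = [set x | dot v x = dot v p]].

Definition smooth_set C :=
  [/\ convex_set C, C° !=set0 &
    forall p H1 H2, boundary C p ->
      supporting_hyperplane C p H1 -> supporting_hyperplane C p H2 -> H1 = H2].

Definition polar C : set 'rV[R]_n :=
  [set y | forall x, C x -> dot x y <= 1].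

(* Equal to +oo when v lies in no t *: C. *)
Definition gauge C v : \bar R :=
  ereal_inf [set t%:E | t in [set t : R | 0 <= t /\ [set t *: x | x in C] v]].

Definition affine_set A :=
  forall x y (t : R), A x -> A y -> A ((1 - t) *: x + t *: y).

Definition affine_hull A : set 'rV[R]_n := smallest affine_set A.

Definition argmin S (f : 'rV[R]_n -> R) : set 'rV[R]_n :=
  [set x | S x /\ forall y, S y -> f x <= f y].

Definition dom (psi : 'rV[R]_n -> \bar R) : set 'rV[R]_n :=
  [set x | (psi x < +oo)%E].

Definition epigraph (psi : 'rV[R]_n -> \bar R) : set ('rV[R]_n * R^o) :=
  [set z | (psi z.1 <= (z.2 : R)%:E)%E].

Definition proper_closed_convex (psi : 'rV[R]_n -> \bar R) :=
  [/\ (forall x, psi x != -oo%E), dom psi !=set0,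
      closed (epigraph psi) & convex_set (epigraph psi)].

(* On the interior of its domain a proper psi coincides with its real-valued
   version [fine \o psi], which carries the derivatives. *)
Definition legendre (psi : 'rV[R]_n -> \bar R) :=
  let f : 'rV[R]_n -> R^o := fine \o psi in
  [/\ proper_closed_convex psi,
      (dom psi)° !=set0,
      (forall x, (dom psi)° x -> differentiable f x),
      (forall x y (t : R), (dom psi)° x -> (dom psi)° y -> x <> y ->
        0 < t < 1 -> f ((1 - t) *: x + t *: y) < (1 - t) * f x + t * f y) &
      (forall (u : nat -> 'rV[R]_n) p,
        (forall k, (dom psi)° (u k)) -> u @ \oo --> p ->
        boundary (dom psi) p -> enorm (grad f (u k)) @[k --> \oo] --> +oo)].

Definition bregman (phi : 'rV[R]_n -> R) x y : R :=
  phi x - phi y - dot (grad phi y) (x - y).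

Definition bregman_proj (phi : 'rV[R]_n -> R) S y : set 'rV[R]_n :=
  argmin S (fun x => bregman phi x y).

Definition robust_points (a0 : 'rV[R]_n) (phi : 'rV[R]_n -> R) X (w : R) :=
  argmin X (fun x => dot a0 x + w * phi x).

Definition central_points (a0 : 'rV[R]_n) (phi : 'rV[R]_n -> R) X
    (xR : 'rV[R]_n) (w : R) :=
  argmin X (fun x => dot a0 x + w * bregman phi x xR).

(* When V is bounded, the polar of V is a neighbourhood of 0, so its gauge is
   finite and [fine] does not alter it. *)
Definition gauge_potential (g : R -> R) V : 'rV[R]_n -> R :=
  fun x => g (fine (gauge (polar V) x)).

End Euclidean.

(* A function on the line is Legendre when it is so as a function on R^1. *)
Definition legendre1 {R : realType} (g : R -> \bar R) :=
  legendre (fun s : 'rV[R]_1 => g (s 0 0)).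

(* Main.v *)
Require Import Defs.
From mathcomp Require Import all_boot all_order all_algebra.
From mathcomp Require Import all_classical all_reals all_analysis.
From mathcomp Require Import ring lra.

Set Implicit Arguments.
Unset Strict Implicit.
Unset Printing Implicit Defensive.

Import Order.TTheory GRing.Theory Num.Theory.
Import numFieldNormedType.Exports.

Local Open Scope classical_set_scope.
Local Open Scope ring_scope.

(** The argument rests on two facts about the support function
    [support V x], the maximum of [dot v x] over [v] in [V], which is the gauge
    of the polar of [V] ([gauge_polar]), so that [phi x = g (support V x)].

    Strict convexity of [V] makes the maximizer [v] of [dot v x] unique when
    [x <> 0]; by compactness the maximizers at nearby points stay close to [v],
    hence [support V] has derivative [dot v d] at [x] in every direction [d]
    ([support_is_derive], an instance of Danskin's theorem).  As [g'(0) = 0], the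
    possible kink of [support V] at [0] disappears in [phi], which therefore has
    directional derivatives [dot (grad phi x) d] everywhere, with
    [grad phi 0 = 0] ([gauge_potential_grad], [gauge_potential_grad0]).
    Smoothness of [V] plays the dual role: a point of [V] maximizing both [x] and
    [y] with the same value forces [x = y], which makes [phi] strictly convex
    ([gauge_potential_strictly_convex]).

    Since [phi 0 = 0] and [grad phi 0 = 0], the divergence from [0] is [phi]
    itself, so the hypothesis on projections says that [xR] minimizes [phi] on
    the whole affine hull of [X].  The hull contains the full line through [xR]
    and any [x] in [X], so [dot (grad phi xR) (x - xR) = 0]
    ([argmin_affine_hull_grad]).  The linear term of the divergence from [xR] thus
    vanishes on [X]: there the central path objective differs from the robust
    path objective by the constant [w * phi xR].  Both path points then minimize
    the same strictly convex function on the convex set [X], and coincide. *)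

(** * The Euclidean inner product *)
Section Dot.
Context {R : realType} {n : nat}.
Implicit Types (x y v : 'rV[R]_n) (a : R).

Lemma dotC x y : dot x y = dot y x.
Proof. by apply: eq_bigr => i _; rewrite mulrC. Qed.

Lemma dotDr x y v : dot v (x + y) = dot v x + dot v y.
Proof. by rewrite /dot -big_split; apply: eq_bigr => i _; rewrite mxE mulrDr. Qed.

Lemma dotZr a x v : dot v (a *: x) = a * dot v x.
Proof.
by rewrite /dot mulr_sumr; apply: eq_bigr => i _; rewrite mxE mulrCA.
Qed.

Lemma dotDl x y v : dot (x + y) v = dot x v + dot y v.
Proof. by rewrite dotC dotDr !(dotC v). Qed.

Lemma dotZl a x v : dot (a *: x) v = a * dot x v.
Proof. by rewrite dotC dotZr dotC. Qed.

Lemma dot0r v : dot v 0 = 0.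
Proof. by rewrite -(scale0r (0 : 'rV[R]_n)) dotZr mul0r. Qed.

Lemma dot0l v : dot 0 v = 0.
Proof. by rewrite dotC dot0r. Qed.

Lemma dotBr x y v : dot v (x - y) = dot v x - dot v y.
Proof. by rewrite dotDr -scaleN1r dotZr mulN1r. Qed.

Lemma dotBl x y v : dot (x - y) v = dot x v - dot y v.
Proof. by rewrite dotC dotBr !(dotC v). Qed.

Lemma dot_ge0 x : 0 <= dot x x.
Proof. by apply: sumr_ge0 => i _; exact: sqr_ge0. Qed.

Lemma dot_eq0 x : dot x x = 0 -> x = 0.
Proof.
move=> /eqP; rewrite psumr_eq0 => [/allP x0|i _]; last exact: sqr_ge0.
apply/rowP => i; rewrite mxE.
by have := x0 i (mem_index_enum i); rewrite mulf_eq0 orbb => /eqP.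
Qed.

Lemma dot_gt0 x : x <> 0 -> 0 < dot x x.
Proof. by move=> x0; rewrite lt_def dot_ge0 andbT; apply/eqP => /dot_eq0. Qed.

Lemma dot_delta v i : dot v (delta_mx 0 i) = v 0 i.
Proof.
rewrite /dot (bigD1 i) //= mxE !eqxx mulr1 big1 ?addr0 // => j ji.
by rewrite mxE (negPf ji) andbF mulr0.
Qed.

Lemma dot_continuous x : continuous (fun v => dot v x : R^o).
Proof.
apply: continuous_big => [|i _ v]; first exact: add_continuous.
by apply: continuousM; [exact: coord_continuous|exact: cst_continuous].
Qed.

End Dot.

Lemma half_in_open01 (R : realType) : 0 < (2^-1 : R) < 1.
Proof. by rewrite invr_gt0 ltr0n /= invf_lt1 ?ltr0n ?ltr1n. Qed.

(** * Support function and gauge of the polar *)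

Section Support.
Context {R : realType} {n : nat}.
Implicit Types (x y d v : 'rV[R]_n) (V : set 'rV[R]_n).

Definition support V x : R := sup [set dot v x | v in V].

Lemma support_max V v x :
  V v -> (forall u, V u -> dot u x <= dot v x) -> support V x = dot v x.
Proof.
move=> Vv vmax; apply/eqP; rewrite eq_le; apply/andP; split.
  by apply: ge_sup => [|_ [u Vu <-]]; [exists (dot v x), v|exact: vmax].
apply: ub_le_sup; last by exists v.
by exists (dot v x) => _ [u Vu <-]; exact: vmax.
Qed.

Lemma compact_linear_max V x : V !=set0 -> compact V ->
  exists2 v, V v & forall u, V u -> dot u x <= dot v x.
Proof.
move=> V0 cV.
have [|v Vv vmax] := compact_EVT_max (f := fun v => dot v x) V0 cV.
  by apply: continuous_subspaceT; exact: dot_continuous.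
by exists v; [exact/set_mem|move=> u Vu; apply: vmax; exact/mem_set].
Qed.

Lemma support_attained V x : V !=set0 -> compact V ->
  exists2 v, V v & dot v x = support V x.
Proof.
move=> V0 cV; have [v Vv vmax] := compact_linear_max x V0 cV.
by exists v => //; rewrite (support_max Vv).
Qed.

Lemma dot_le_support V v x : compact V -> V v -> dot v x <= support V x.
Proof.
move=> cV Vv; have [|u Vu umax] := compact_linear_max x _ cV; first by exists v.
by rewrite (support_max Vu) //; exact: umax.
Qed.

Lemma supportD V x y : V !=set0 -> compact V ->
  support V (x + y) <= support V x + support V y.
Proof.
move=> V0 cV; have [v Vv <-] := support_attained (x + y) V0 cV.
by rewrite dotDr lerD // dot_le_support.
Qed.

Lemma supportZ V (a : R) x : V !=set0 -> compact V -> 0 <= a ->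
  support V (a *: x) = a * support V x.
Proof.
move=> V0 cV a0; have [v Vv vE] := support_attained x V0 cV.
rewrite -vE -dotZr; apply: support_max => // u Vu.
by rewrite !dotZr ler_wpM2l // vE dot_le_support.
Qed.

Lemma interior_move V v x : V° v -> exists2 e : R, 0 < e & V (v + e *: x).
Proof.
move=> Vv.
have : (fun e : R => v + e *: x) @ nbhs 0 --> v + 0 *: x.
  by apply: cvgD; [exact: cvg_cst|apply: cvgZr_tmp => //; exact: cvg_id].
rewrite scale0r addr0 => /(_ _ Vv) /nbhs_ballP[e /= e0 eV].
exists (e / 2); first by rewrite divr_gt0.
apply: eV; rewrite /ball /= sub0r normrN gtr0_norm ?divr_gt0 //.
by rewrite ltr_pdivrMr // mulr_natr mulr2n ltrDl.
Qed.

Lemma support_gt0 V x : compact V -> V° 0 -> x <> 0 -> 0 < support V x.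
Proof.
move=> cV V0 x0; have [e e0] := interior_move x V0; rewrite add0r => Ve.
apply: lt_le_trans (dot_le_support x cV Ve).
by rewrite dotZl mulr_gt0 // dot_gt0.
Qed.

Lemma support0 V : V !=set0 -> compact V -> support V 0 = 0.
Proof.
by move=> V0 cV; have [v _ <-] := support_attained 0 V0 cV; rewrite dot0r.
Qed.

Lemma support_ge0 V x : compact V -> V 0 -> 0 <= support V x.
Proof. by move=> cV V0; rewrite -(dot0l x) dot_le_support. Qed.

(** For [t > 0], [x] lies in [t *: polar V] iff [support V x <= t], so the
    infimum is [support V x].  The point [x = 0] is separate: it is the only one
    for which the scaling factor [t = 0] is admissible. *)
Lemma gauge_polar V x : compact V -> V° 0 ->
  gauge (polar V) x = (support V x)%:E.
Proof.
move=> cV V0; have Vn0 : V !=set0 by exists 0; exact: interior_subset.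
have [->|/eqP x0] := eqVneq x 0.
  rewrite support0 //; apply/eqP; rewrite eq_le; apply/andP; split.
    apply: ereal_inf_lbound; exists 0 => //; split=> //; exists 0.
      by move=> v _; rewrite dot0r.
    by rewrite scaler0.
  by apply: le_ereal_inf_tmp => _ [t [t0 _] <-]; rewrite lee_fin.
have N0 := support_gt0 cV V0 x0.
apply/eqP; rewrite eq_le; apply/andP; split.
  apply: ereal_inf_lbound; exists (support V x) => //; split; first exact: ltW.
  exists ((support V x)^-1 *: x); last by rewrite scalerA divff ?gt_eqF ?scale1r.
  by move=> v Vv; rewrite dotZr ler_pdivrMl // mulr1 dot_le_support.
apply: le_ereal_inf_tmp => _ [t [t0 [y yV xE]] <-]; rewrite lee_fin.
have [v Vv <-] := support_attained x Vn0 cV.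
by rewrite -xE dotZr ler_piMr // yV.
Qed.

(** * Maximizers of linear forms: the geometry of smooth and rotund sets *)

(** At an interior point, a small step in the direction [x] would increase
    [dot _ x]. *)
Lemma maximizer_boundary V v x : x <> 0 -> V v ->
  (forall u, V u -> dot u x <= dot v x) -> boundary V v.
Proof.
move=> x0 Vv vmax; split; first exact: subset_closure.
move=> /(interior_move x)[e e0 /vmax].
by rewrite dotDl dotZl gerDl leNgt mulr_gt0 ?dot_gt0.
Qed.

(** The midpoint of two distinct maximizers would be an interior maximizer. *)
Lemma maximizer_unique V u v x : strictly_convex_set V -> x <> 0 ->
  V u -> (forall w, V w -> dot w x <= dot u x) ->
  V v -> (forall w, V w -> dot w x <= dot v x) -> u = v.
Proof.
move=> [_ _ Vsc] x0 Vu umax Vv vmax; apply: contrapT => uv.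
have uvE : dot u x = dot v x.
  by apply/eqP; rewrite eq_le umax // vmax.
have h01 := half_in_open01 R.
have bu := maximizer_boundary x0 Vu umax.
have bv := maximizer_boundary x0 Vv vmax.
have /(interior_move x)[e e0 /umax] := Vsc _ _ _ bu bv uv h01.
rewrite !dotDl !dotZl uvE -mulrDl subrK mul1r gerDl leNgt.
by rewrite mulr_gt0 ?dot_gt0.
Qed.

(** Equality of the supporting hyperplanes only makes [x] and [y] proportional;
    the common value [dot v x = dot v y], when nonzero, fixes the factor to be
    [1]. *)
Lemma smooth_normal_unique V v x y : smooth_set V -> boundary V v ->
  x <> 0 -> y <> 0 ->
  (forall u, V u -> dot u x <= dot v x) ->
  (forall u, V u -> dot u y <= dot v y) -> dot v x = dot v y ->
  dot v x <> 0 -> x = y.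
Proof.
move=> [_ _ Vsm] bv x0 y0 xv yv vxy vx0.
have H : [set u | dot x u = dot x v] = [set u | dot y u = dot y v].
  apply: (Vsm _ _ _ bv); [exists x|exists y]; split=> // u Vu;
    by rewrite ![dot _ u]dotC ![dot _ v]dotC; first [exact: xv|exact: yv].
rewrite ![dot _ v]dotC -vxy in H.
have xx : dot x x != 0 by rewrite gt_eqF ?dot_gt0.
have yy : dot y y != 0 by rewrite gt_eqF ?dot_gt0.
(* The multiple of [x] lying on its hyperplane must lie on that of [y], and
   conversely; hence [dot x y] is both [dot x x] and [dot y y]. *)
have yx : dot y x = dot x x.
  have : [set u | dot x u = dot v x] ((dot v x / dot x x) *: x).
    by rewrite /= dotZr divfK.
  rewrite H /= dotZr -mulrA => /(canRL (mulKf (introN eqP vx0))).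
  by rewrite mulVf ?(introN eqP vx0) // mulrC => /(canRL (divfK xx)); rewrite mul1r.
have xy : dot x y = dot y y.
  have : [set u | dot y u = dot v x] ((dot v x / dot y y) *: y).
    by rewrite /= dotZr divfK.
  rewrite -H /= dotZr -mulrA => /(canRL (mulKf (introN eqP vx0))).
  by rewrite mulVf ?(introN eqP vx0) // mulrC => /(canRL (divfK yy)); rewrite mul1r.
apply/eqP; rewrite -subr_eq0; apply/eqP/dot_eq0.
by rewrite dotBr !dotBl yx xy !subrr.
Qed.

End Support.

(** * Directional derivatives *)

Section Expansion.
Context {R : realType} {W : normedModType R}.
Implicit Types (f : W -> R^o) (x d : W) (c : R).

(** Clearing the denominator of the difference quotient gives a bound in which
    [h = 0] is harmless and which reads the same along a line and in [W]. *)
Lemma is_derive_expansion f x d c :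
  is_derive x d f c <->
  forall e : R, 0 < e -> exists2 r : R, 0 < r & forall h : R, `|h| < r ->
    `|f (h *: d + x) - f x - h * c| <= e * `|h|.
Proof.
set q := fun h : R => h^-1 *: ((f \o shift x) (h *: d) - f x).
have qE (h : R) : h != 0 ->
    `|f (h *: d + x) - f x - h * c| = `|c - q h| * `|h|.
  move=> h0; have qh : q h * h = f (h *: d + x) - f x.
    by rewrite -[q h]/(h^-1 * (f (h *: d + x) - f x)) mulrAC mulVf // mul1r.
  by rewrite -normrM mulrBl qh [c * h]mulrC distrC.
split=> [[dvb dval] e e0|fe].
  have : q h @[h --> 0^'] --> (c : R^o) by rewrite -dval.
  move=> /cvgrPdist_le /(_ e e0).
  move=> -[r /= r0 qr]; exists r => // h hr.
  have [->|h0] := eqVneq h 0.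
    by rewrite scale0r add0r subrr mul0r subr0 !normr0 mulr0.
  rewrite qE // ler_wpM2r //; apply: qr => //=.
  by rewrite /ball /= sub0r normrN.
have qc : q h @[h --> 0^'] --> (c : R^o).
  apply/cvgrPdist_le => e e0; have [r r0 fr] := fe e e0.
  exists r => //= h; rewrite /ball /= sub0r normrN => hr h0.
  by have := fr h hr; rewrite qE // ler_pM2r // normr_gt0.
by apply: DeriveDef; [apply/cvg_ex; exists c|exact: cvg_lim qc].
Qed.

End Expansion.

Section DirectionalDerivative.
Context {R : realType} {W : normedModType R}.
Implicit Types (f : W -> R^o) (x d : W) (c : R).

Lemma is_derive_line f x d c :
  is_derive x d f c <->
  is_derive (0 : R^o) (1 : R^o) (fun h : R^o => f (h *: d + x)) c.
Proof.
have lineE (h : R) : (h *: (1 : R^o) + 0) = h by rewrite addr0 [_ *: _]mulr1.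
by split=> /is_derive_expansion fe; apply/is_derive_expansion => e /fe[r r0 fr];
  exists r => // h /fr; rewrite lineE scale0r add0r.
Qed.

(** A step of either sign is available, so a nonzero slope [c] would allow a
    decrease by stepping against its sign. *)
Lemma is_derive_min f x d c :
  is_derive x d f c -> (forall h : R, f x <= f (h *: d + x)) -> c = 0.
Proof.
move=> /is_derive_expansion fe fmin; apply: contrapT => /eqP c0.
have c1 : 0 < `|c| by rewrite normr_gt0.
have [|r r0 fr] := fe (`|c| / 2); first by rewrite divr_gt0.
(* The step [- t * c] has length [r / 2] and, with the error bound
   [|c| / 2 * |h|], decreases [f] by at least [t * c ^+ 2 / 2]. *)
pose t := r / 2 / `|c|; have t0 : 0 < t by rewrite !divr_gt0.
have tc : t * `|c| = r / 2 by rewrite divfK // gt_eqF.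
have nh : `|- t * c| = r / 2 by rewrite normrM normrN (gtr0_norm t0).
have := fr (- t * c); rewrite nh ltr_pdivrMr // mulr_natr mulr2n ltrDl r0.
have cc : - t * c * c = - (t * `|c| ^+ 2).
  by rewrite real_normK ?num_real // expr2 !mulNr mulrA.
move=> /(_ isT) /(le_trans (ler_norm _)); rewrite cc opprK -tc.
have := fmin (- t * c); rewrite -subr_ge0.
have : 0 < t * `|c| ^+ 2 by rewrite mulr_gt0 // exprn_gt0.
by move: (f _ - f x); move: (`|c|) => k D; nra.
Qed.

Lemma is_derive_squeeze f (u : R -> R) x d :
  is_derive (0 : R^o) (1 : R^o) (u : R^o -> R^o) 0 -> u 0 = 0 -> f x = 0 ->
  (forall h : R, 0 <= f (h *: d + x) <= u h) -> is_derive x d f 0.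
Proof.
move=> /is_derive_expansion ue u0 fx0 fu; apply/is_derive_expansion => e /ue[r r0 ur].
exists r => // h /ur; rewrite [_ *: 1]mulr1 addr0 u0 fx0 !mulr0 !subr0.
by move=> /(le_trans (ler_norm _)); apply: le_trans; have /andP[f0 ?] := fu h;
  rewrite ger0_norm.
Qed.

End DirectionalDerivative.

(** The gradient collects derivatives along the coordinate axes only; it
    represents all directional derivatives as soon as these are linear in the
    direction. *)
Lemma grad_unique {R : realType} {n : nat} (f : 'rV[R]_n -> R^o) x p :
  (forall d, is_derive x d f (dot p d)) -> grad f x = p.
Proof.
move=> fp; apply/rowP => i; rewrite mxE.
by have -> := derive_val (is_derive := fp (delta_mx 0 i)); rewrite dot_delta.
Qed.

(** * Differentiability of the support function *)

Section SupportDerivative.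
Context {R : realType} {n : nat}.
Implicit Types (x y d v : 'rV[R]_n) (V : set 'rV[R]_n).

(** The points [u] of [V] with [dot u d] far from [dot v d] form a compact set
    [K] that avoids the unique maximizer [v], so [dot _ x] stays below [dot v x]
    by a fixed gap on [K].  Moving [x] by [h *: d] changes each [dot u x] by at
    most [|h| * B], so no maximizer enters [K] while [h] is small compared with
    the gap. *)
Lemma maximizer_stable V v x d (e : R) : compact V -> V v ->
  (forall u, V u -> dot u x <= dot v x) ->
  (forall u, V u -> (forall w, V w -> dot w x <= dot u x) -> u = v) ->
  0 < e -> exists2 r : R, 0 < r & forall (h : R) u, `|h| < r -> V u ->
    (forall w, V w -> dot w (h *: d + x) <= dot u (h *: d + x)) ->
    `|dot u d - dot v d| < e.
Proof.
move=> cV Vv vmax vuniq e0.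
pose K := V `&` [set u | e <= `|dot u d - dot v d|].
have cK : compact K.
  apply: compact_closedI => //.
  apply: (@closed_comp _ R^o (fun u => `|dot u d - dot v d|) [set s | e <= s]).
    move=> u _.
    have du : (dot w d - dot v d : R^o) @[w --> u] -->
        (dot u d - dot v d : R^o).
      exact: (cvgB (@dot_continuous _ _ d u) (cvg_cst _)).
    exact: (cvg_norm du).
  exact: closed_ge.
have [K0|nK] := pselect (K !=set0); last first.
  exists 1 => // h u _ Vu _; rewrite ltNge; apply/negP => eu.
  by apply: nK; exists u.
have [m [Vm em] mmax] := compact_linear_max x K0 cK.
have mv : dot m x < dot v x.
  rewrite lt_neqAle vmax // andbT; apply/negP => /eqP mvE.
  have mv : m = v by apply: vuniq => // w; rewrite mvE; exact: vmax.
  by move: em; rewrite /= mv subrr normr0 leNgt e0.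
pose B := `|support V d| + `|support V (- d)| + 1.
have B0 : 0 < B by rewrite ltr_wpDl // addr_ge0.
have BV u : V u -> `|dot u d| <= B.
  move=> Vu; have := dot_le_support d cV Vu; have := dot_le_support (- d) cV Vu.
  rewrite -scaleN1r dotZr scaleN1r mulN1r /B ler_norml.
  have := ler_norm (support V d); have := ler_norm (support V (- d)).
  have := normr_ge0 (support V d); have := normr_ge0 (support V (- d)).
  move: (`|support V d|) (`|support V (- d)|) => a b.
  by move: (support V d) (support V (- d)) (dot u d) => p q s; clear; lra.
exists ((dot v x - dot m x) / (2 * B)) => [|h u].
  by rewrite divr_gt0 ?subr_gt0 // mulr_gt0.
rewrite ltr_pdivlMr ?mulr_gt0 // => hr Vu umax; rewrite ltNge; apply/negP => eu.
have := umax v Vv; have := mmax u (conj Vu eu).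
rewrite !dotDr !dotZr.
have hB w : V w -> `|h * dot w d| <= `|h| * B.
  by move=> Vw; rewrite normrM ler_wpM2l // BV.
have := hB u Vu; have := hB v Vv; rewrite !ler_norml; move: hr.
move: (`|h|) (h * dot u d) (h * dot v d) => k a b.
by move: (dot u x) (dot v x) (dot m x) => p q s; clear; lra.
Qed.

(** Danskin's theorem.  If [u] maximizes at [h *: d + x], testing [v] there and
    [u] at [x] puts the error of the linear expansion between [0] and
    [h * (dot u d - dot v d)], and [dot u d] tends to [dot v d]. *)
Lemma support_is_derive V v x d : compact V -> V v ->
  (forall u, V u -> dot u x <= dot v x) ->
  (forall u, V u -> (forall w, V w -> dot w x <= dot u x) -> u = v) ->
  is_derive x d (support V : _ -> R^o) (dot v d).
Proof.
move=> cV Vv vmax vuniq; apply/is_derive_expansion => e e0.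
have V0 : V !=set0 by exists v.
have [r r0 stab] := maximizer_stable d cV Vv vmax vuniq e0.
exists r => // h hr.
have [u Vu umax] := compact_linear_max (h *: d + x) V0 cV.
have /ltW ue := stab h u hr Vu umax.
rewrite (support_max Vu umax) (support_max Vv vmax).
have := umax v Vv; rewrite !dotDr !dotZr -subr_ge0 => D0.
rewrite ger0_norm; last by move: D0; congr (_ <= _); lra.
have := vmax u Vu; rewrite -subr_ge0 => uv.
apply: (@le_trans _ _ (h * (dot u d - dot v d))).
  by rewrite -subr_ge0; move: uv; congr (_ <= _); lra.
by apply: le_trans (ler_norm _) _; rewrite normrM mulrC ler_wpM2r.
Qed.

End SupportDerivative.

(** * Legendre functions on the line *)

Section LegendreLine.
Context {R : realType}.
Implicit Types (g : R -> R) (s t a b : R).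

Definition strictly_convex_fun g := forall a b t, a <> b -> 0 < t < 1 ->
  g ((1 - t) * a + t * b) < (1 - t) * g a + t * g b.

(** A real-valued [g] has the whole line as domain, so the conditions
    that [legendre] imposes on the interior of the domain hold everywhere. *)
Lemma legendre1_strictly_convex g :
  legendre1 (fun s => (g s)%:E) -> strictly_convex_fun g.
Proof.
move=> [_ _ _ gsc _] a b t ab t01.
have domT : dom (fun s : 'rV[R]_1 => (g (s 0 0))%:E) = setT.
  by apply/seteqP; split => // s _; rewrite /dom /= ltry.
rewrite domT interiorT in gsc.
have := gsc (const_mx a) (const_mx b) t I I; rewrite /= !mxE; apply => //.
by move=> /rowP/(_ 0); rewrite !mxE.
Qed.

Lemma legendre1_is_derive g s : legendre1 (fun s => (g s)%:E) ->
  is_derive (s : R^o) (1 : R^o) (g : R^o -> R^o) (derive1 (g : R -> R^o) s).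
Proof.
move=> [_ _ gd _ _].
have domT : dom (fun s : 'rV[R]_1 => (g (s 0 0))%:E) = setT.
  by apply/seteqP; split => // x _; rewrite /dom /= ltry.
rewrite domT interiorT in gd.
have [c] : exists c, is_derive (const_mx s : 'rV[R]_1) (const_mx 1)
    (fun x => g (x 0 0) : R^o) c.
  by eexists; apply: derivableP; apply: diff_derivable; exact: gd.
move=> /is_derive_expansion ge.
have gc : is_derive (s : R^o) (1 : R^o) (g : R^o -> R^o) c.
  apply/is_derive_expansion => e /ge[r r0 gr]; exists r => // h /gr.
  by rewrite !mxE.
by rewrite derive1E (derive_val (is_derive := gc)).
Qed.

Lemma strictly_convex_gt0 g a : strictly_convex_fun g ->
  (forall s, 0 <= g s) -> g 0 = 0 -> a <> 0 -> 0 < g a.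
Proof.
move=> gsc gp g0 a0.
have h01 := half_in_open01 R.
have := gsc 0 a _ (nesym a0) h01; rewrite g0 !mulr0 !add0r.
by move=> /(le_lt_trans (gp _)); rewrite pmulr_rgt0 // invr_gt0 ltr0n.
Qed.

(** For [a > 0], the value [g a] lies below the chord of [g] over [0] and [b],
    which rises from [0] to [g b]. *)
Lemma strictly_convex_mono g a b : strictly_convex_fun g ->
  (forall s, 0 <= g s) -> g 0 = 0 -> 0 <= a -> a < b -> g a < g b.
Proof.
move=> gsc gp g0; rewrite le_eqVlt => /predU1P[<- b0|a0 ab].
  by rewrite g0; apply: strictly_convex_gt0 => //; apply/eqP; rewrite gt_eqF.
have b0 := lt_trans a0 ab.
have t01 : 0 < a / b < 1 by rewrite divr_gt0 // ltr_pdivrMr // mul1r.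
have b1 : 0 <> b by apply/eqP; rewrite lt_eqF.
have := gsc 0 b _ b1 t01; rewrite g0 !mulr0 !add0r divfK ?gt_eqF // => h.
apply: (lt_le_trans h); rewrite ler_piMl //.
by case/andP: t01 => _ /ltW.
Qed.

End LegendreLine.

(** * The potential [phi] *)

Section GaugePotential.
Context {R : realType} {n : nat}.
Implicit Types (x y d v : 'rV[R]_n).
Variables (V : set 'rV[R]_n) (g : R -> R).
Hypotheses (cV : compact V) (V0 : V° 0).
Hypotheses (g_ge0 : forall s, 0 <= g s) (g0 : g 0 = 0).
Hypothesis g_sc : strictly_convex_fun g.

Let phi := gauge_potential g V.

Let Vn0 : V !=set0. Proof. by exists 0; exact: interior_subset. Qed.

Lemma gauge_potentialE x : phi x = g (support V x).
Proof. by rewrite /phi /gauge_potential gauge_polar. Qed.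

(** The support function of a smooth set fails to be strictly convex only along
    rays, and two points of a ray with the same nonzero value are equal.  A maximizer for the combination
    that reached the common value would maximize both [x] and [y]. *)
Lemma support_strictly_convex_on_levels x y (t : R) : smooth_set V -> x <> y ->
  support V x = support V y -> 0 < t < 1 ->
  support V ((1 - t) *: x + t *: y) < support V x.
Proof.
move=> sV xy NxNy /andP[t0 t1]; set z := _ + _.
have t1' : 0 < 1 - t by rewrite subr_gt0.
have [v Vv vz] := support_attained z Vn0 cV.
have vx := dot_le_support x cV Vv; have vy := dot_le_support y cV Vv.
have zE : support V z = (1 - t) * dot v x + t * dot v y.
  by rewrite -vz dotDr !dotZr.
rewrite lt_neqAle; apply/andP; split; last first.
  by rewrite zE; move: vy; rewrite -NxNy; nra.
apply/negP => /eqP zx.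
have vxE : dot v x = support V x.
  apply/eqP; rewrite eq_le vx /= -zx zE; move: vy; rewrite -NxNy -zx zE.
  by nra.
have vyE : dot v y = support V y.
  apply/eqP; rewrite eq_le vy /= -NxNy -zx zE; move: vx; rewrite -zx zE.
  by nra.
have x0 : x <> 0.
  move=> x0; have yN0 : y <> 0 by move=> y0; apply: xy; rewrite x0 y0.
  by have := support_gt0 cV V0 yN0; rewrite -NxNy x0 support0 // ltxx.
have y0 : y <> 0.
  by move=> y0; have := support_gt0 cV V0 x0; rewrite NxNy y0 support0 // ltxx.
have xmax u : V u -> dot u x <= dot v x by rewrite vxE; exact: dot_le_support.
have ymax u : V u -> dot u y <= dot v y by rewrite vyE; exact: dot_le_support.
have bv := maximizer_boundary x0 Vv xmax.
apply: xy; apply: (smooth_normal_unique sV bv) => //.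
  by rewrite vxE vyE.
by apply/eqP; rewrite vxE gt_eqF // support_gt0.
Qed.

(** If [support V] takes different values at [x] and [y], strictness comes from
    [g]; otherwise it comes from [support V]. *)
Lemma gauge_potential_strictly_convex x y (t : R) : smooth_set V -> x <> y ->
  0 < t < 1 -> phi ((1 - t) *: x + t *: y) < (1 - t) * phi x + t * phi y.
Proof.
move=> sV xy t01; rewrite !gauge_potentialE.
have := t01 => /andP[t0 t1]; have t1' : 0 < 1 - t by rewrite subr_gt0.
have V00 := interior_subset V0.
have gmono a b : 0 <= a -> a < b -> g a < g b by exact: strictly_convex_mono.
have [NxNy|/eqP NxNy] := eqVneq (support V x) (support V y).
  rewrite -NxNy -mulrDl subrK mul1r; apply: gmono; first exact: support_ge0.
  exact: support_strictly_convex_on_levels.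
apply: le_lt_trans (g_sc NxNy t01).
have : support V ((1 - t) *: x + t *: y) <=
    (1 - t) * support V x + t * support V y.
  by rewrite -!supportZ ?supportD // ltW.
rewrite le_eqVlt => /predU1P[-> //|lt]; apply/ltW/gmono => //.
exact: support_ge0.
Qed.

Hypothesis g_der : forall s : R,
  is_derive (s : R^o) (1 : R^o) (g : R^o -> R^o) (derive1 (g : R -> R^o) s).
Hypothesis dg0 : derive1 (g : R -> R^o) 0 = 0.

(** For [h >= 0] (resp. [h <= 0]), [phi (h *: d)] is the first (resp. second)
    summand of the bound used below, whose derivative at [0] is a multiple of
    [g'(0)]. *)
Lemma gauge_potential_is_derive0 d :
  is_derive (0 : 'rV[R]_n) d (phi : _ -> R^o) 0.
Proof.
have V00 := interior_subset V0.
have gN (c : R) :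
    is_derive (0 : R^o) (1 : R^o) (fun h : R^o => g (c * h) : R^o) 0.
  have cd : is_derive (0 : R^o) (1 : R^o) (fun h : R^o => c * h : R^o) c.
    apply/is_derive_expansion => e e0; exists 1 => // h _.
    by rewrite [_ *: 1]mulr1 addr0 mulr0 subr0 mulrC subrr normr0 mulr_ge0 // ltW.
  have := g_der (c * 0); rewrite {2}mulr0 dg0 => gd.
  have := is_derive1_comp gd cd.
  by rewrite mul0r.
apply: (@is_derive_squeeze _ _ _
  (fun h => g (support V d * h) + g (- support V (- d) * h))).
- have := is_deriveD (gN (support V d)) (gN (- support V (- d))).
  by rewrite addr0.
- by rewrite !mulr0 g0 addr0.
- by rewrite gauge_potentialE support0.
move=> h; rewrite addr0 gauge_potentialE g_ge0 /=.
have [h0|/ltW h0] := leP 0 h.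
  by rewrite supportZ // mulrC lerDl.
have -> : h *: d = (- h) *: (- d) by rewrite scaleNr scalerN opprK.
by rewrite supportZ ?oppr_ge0 // mulNr -mulrN mulrC mulNr lerDr.
Qed.

Lemma gauge_potential_is_derive x : strictly_convex_set V ->
  exists p, forall d, is_derive x d (phi : _ -> R^o) (dot p d).
Proof.
move=> scV; have [->|/eqP x0] := eqVneq x 0.
  by exists 0 => d; rewrite dot0l; exact: gauge_potential_is_derive0.
have [v Vv vmax] := compact_linear_max x Vn0 cV.
exists (derive1 (g : R -> R^o) (support V x) *: v) => d; rewrite dotZl.
have vuniq u : V u -> (forall w, V w -> dot w x <= dot u x) -> u = v.
  by move=> Vu umax; exact: maximizer_unique scV x0 Vu umax Vv vmax.
apply/is_derive_line.
have /is_derive_line Nd := support_is_derive d cV Vv vmax vuniq.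
have := g_der (support V (0 *: d + x)); rewrite {2}scale0r add0r => gd.
have := is_derive1_comp gd Nd.
congr (is_derive _ _ _ _); apply/funext => h /=.
by rewrite gauge_potentialE.
Qed.

Lemma gauge_potential_grad x d : strictly_convex_set V ->
  is_derive x d (phi : _ -> R^o) (dot (grad phi x) d).
Proof.
move=> scV; have [p pd] := gauge_potential_is_derive x scV.
by rewrite (grad_unique pd).
Qed.

Lemma gauge_potential_grad0 : grad phi 0 = 0.
Proof.
by apply: grad_unique => d; rewrite dot0l; exact: gauge_potential_is_derive0.
Qed.

Lemma bregman_proj0 S : bregman_proj phi S 0 = argmin S phi.
Proof.
rewrite /bregman_proj; congr argmin; apply/funext => x.
rewrite /bregman gauge_potential_grad0 dot0l (gauge_potentialE 0).
by rewrite support0 // g0 !subr0.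
Qed.

End GaugePotential.

(** * Minimizers on convex sets and on affine hulls *)

Lemma affine_hull_line {R : realType} {n : nat} (X : set 'rV[R]_n) x y (t : R) :
  X x -> X y -> affine_hull X (t *: (y - x) + x).
Proof.
move=> Xx Xy A /= [aA XA].
have -> : t *: (y - x) + x = (1 - t) *: x + t *: y.
  by rewrite scalerBr scalerBl scale1r addrC addrA addrAC.
by apply: aA; exact: XA.
Qed.

(** The line through [x] and [y] stays in the hull on both sides of [x], so the
    derivative along it vanishes instead of being merely nonnegative. *)
Lemma argmin_affine_hull_grad {R : realType} {n : nat} (f : 'rV[R]_n -> R^o)
    (X : set 'rV[R]_n) x y :
  (forall d, is_derive x d f (dot (grad f x) d)) ->
  X x -> X y -> argmin (affine_hull X) f x -> dot (grad f x) (y - x) = 0.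
Proof.
move=> fd Xx Xy [_ fmin]; apply: (is_derive_min (fd _)) => h.
by apply: fmin; exact: affine_hull_line.
Qed.

Lemma argmin_unique {R : realType} {n : nat} (f : 'rV[R]_n -> R)
    (X : set 'rV[R]_n) x y : convex_set X ->
  (forall x y (t : R), x <> y -> 0 < t < 1 ->
    f ((1 - t) *: x + t *: y) < (1 - t) * f x + t * f y) ->
  argmin X f x -> argmin X f y -> x = y.
Proof.
move=> cX fsc [Xx xmin] [Xy ymin]; apply: contrapT => xy.
have h01 := half_in_open01 R.
have Xm : X ((1 - 2^-1) *: x + 2^-1 *: y).
  have /andP[/ltW h0 /ltW h1] := h01.
  rewrite addrC.
  exact: set_mem (cX y x (Itv01 h0 h1) (mem_set Xy) (mem_set Xx)).
have := fsc x y _ xy h01; rewrite ltNge => /negP; apply.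
have fxy : f x = f y by apply/eqP; rewrite eq_le xmin // ymin.
by rewrite -fxy -mulrDl subrK mul1r xmin.
Qed.

(** * Robust path and central path *)

Theorem corollary1 (R : realType) (n : nat) (X V : set 'rV[R]_n)
    (a0 : 'rV[R]_n) (g : R -> R)
    (xR : 'rV[R]_n) (xR' xCP : R -> 'rV[R]_n) :
  let phi := gauge_potential g V in
  X !=set0 -> closed X -> convex_set X ->
  compact V -> smooth_set V -> strictly_convex_set V -> V° 0 ->
  (forall s, 0 <= g s) -> legendre1 (fun s => (g s)%:E) ->
  g 0 = 0 -> derive1 (g : R -> R^o) 0 = 0 ->
  argmin X phi xR ->
  (forall w : R, 0 < w -> robust_points a0 phi X w (xR' w)) ->
  (forall w : R, 0 < w -> central_points a0 phi X xR w (xCP w)) ->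
  bregman_proj phi X 0 = bregman_proj phi (affine_hull X) 0 ->
  forall w : R, 0 < w -> xR' w = xCP w.
Proof.
move=> phi _ _ cX cV sV scV V0 g_ge0 gL g0 dg0 xRmin robust central proj w w0.
have g_sc := legendre1_strictly_convex gL.
have g_der s := legendre1_is_derive s gL.
have Xx := xRmin.1.
have xRaff : argmin (affine_hull X) phi xR.
  by move: xRmin; rewrite -!(bregman_proj0 cV V0 g_ge0 g0 g_der dg0) proj.
have bregmanE x : X x -> bregman phi x xR = phi x - phi xR.
  move=> Xy; have phi_der d :=
    gauge_potential_grad cV V0 g_ge0 g0 g_der dg0 xR d scV.
  by rewrite /bregman (argmin_affine_hull_grad phi_der Xx Xy xRaff) subr0.
have [XC Cmin] := central w w0.
apply: (argmin_unique cX _ (robust w w0)) => [x y t xy t01|].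
  rewrite dotDr !dotZr.
  have := gauge_potential_strictly_convex cV V0 g_ge0 g0 g_sc sV xy t01.
  rewrite -/phi -(ltr_pM2l w0) => h.
  have -> : (1 - t) * (dot a0 x + w * phi x) + t * (dot a0 y + w * phi y) =
    (1 - t) * dot a0 x + t * dot a0 y + w * ((1 - t) * phi x + t * phi y) by ring.
  by rewrite ltrD2l.
split=> // y Xy; have := Cmin y Xy; rewrite !bregmanE // !mulrBr !addrA.
by rewrite lerD2r.
Qed.
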